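(* Let $\mathcal{C}$ be a clutter on a finite set $E$ that satisfies the integral blocking condition and such that $\mathrm{I}(\mathcal{C})$ is an integral polytope. Then $\tilde{\mathcal{C}}$ is minimum-transversal-covered and tilde-invariant, and satisfies the tilde-full condition and the dimension condition.
   Context: A clutter on $E$ is a family of subsets none containing another (members: hyperedges). A transversal is an inclusion-minimal set meeting all hyperedges; $\mathrm{b}(\mathcal{C})$ the transversals, $\mathrm{bn}(\mathcal{C})$ the minimum transversal size, $\mathrm{minb}(\mathcal{C})$ the minimum-size transversals. $\mathcal{C}$ is minimum-transversal-covered if the union of $\mathrm{minb}(\mathcal{C})$ is $E$. A fractional packing is $y:\mathcal{C}\to\mathbb{R}_{\ge0}$ with $\sum_{H\ni a}y(H)\le1$ for every $a\in E$; a maximum fractional packing maximizes $\sum_Hy(H)$, whose maximum is $\mathrm{fpn}(\mathcal{C})$; its support is $\{H:y(H)>0\}$. Integral blocking condition: $\mathrm{fpn}(\mathcal{C})=\mathrm{bn}(\mathcal{C})$. $\tilde{\mathcal{C}}=\{H\in\mathcal{C}:|H\cap B|=1\ \forall B\in\mathrm{minb}(\mathcal{C})\}$. $\mathcal{C}$ is tilde-invariant if $\mathcal{C}=\tilde{\mathcal{C}}$ and it satisfies the integral blocking condition. $\mathcal{C}$ satisfies the tilde-full condition if it is minimum-transversal-covered, satisfies the integral blocking condition, and every hyperedge of $\tilde{\mathcal{C}}$ lies in the support of some maximum fractional packing of $\mathcal{C}$. $\mathcal{C}$ satisfies the dimension condition if (affine dimension of $\{1_H:H\in\tilde{\mathcal{C}}\}$)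 + (affine dimension of $\{1_B:B\in\mathrm{minb}(\tilde{\mathcal{C}})\}$) $=|E|-1$. $\mathrm{I}(\mathcal{C})=\{x\in\mathbb{R}^E:\langle x,1_D\rangle=1\ \forall D\in\mathrm{minb}(\mathcal{C}),\ \langle x,1_D\rangle\ge1\ \forall D\in\mathrm{b}(\mathcal{C}),\ x\ge0\}$. *)

(* Defs.v *)
From mathcomp Require Import all_boot all_order all_algebra.
From mathcomp Require Import boolp classical_sets reals.

Set Implicit Arguments.
Unset Strict Implicit.
Unset Printing Implicit Defensive.

Import Order.TTheory GRing.Theory Num.Theory.
Local Open Scope ring_scope.

Definition clutter (E : finType) (C : {set {set E}}) : Prop :=
  forall H K : {set E}, H \in C -> K \in C -> H \subset K -> H = K.

Definition meets_all (E : finType) (C : {set {set E}}) (B : {set E}) : bool :=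
  [forall H in C, B :&: H != finset.set0].

Definition transversals (E : finType) (C : {set {set E}}) : {set {set E}} :=
  [set B | minset (meets_all C) B]%SET.

(* Every transversal has at most #|E| elements, so the seed #|E| of the minimum
   is harmless when C has a transversal.  The only clutter without transversals
   is [set set0], which has no maximum fractional packing. *)
Definition bn (E : finType) (C : {set {set E}}) : nat :=
  \big[minn/#|E|]_(B in transversals C) #|B|.

Definition minb (E : finType) (C : {set {set E}}) : {set {set E}} :=
  [set B in transversals C | #|B| == bn C]%SET.

Definition min_transversal_covered (E : finType) (C : {set {set E}}) : Prop :=
  finset.cover (minb C) = [set: E]%SET.

Definition tilde (E : finType) (C : {set {set E}}) : {set {set E}} :=
  [set H in C | [forall B in minb C, #|H :&: B| == 1%N]]%SET.

(* Only the values of y on C are ever used. *)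

Definition fractional_packing (R : realType) (E : finType)
    (C : {set {set E}}) (y : {set E} -> R) : Prop :=
  (forall H : {set E}, H \in C -> 0 <= y H) /\
  (forall a : E, \sum_(H in C | a \in H) y H <= 1).

Definition packing_value (R : realType) (E : finType)
    (C : {set {set E}}) (y : {set E} -> R) : R :=
  \sum_(H in C) y H.

Definition max_fractional_packing (R : realType) (E : finType)
    (C : {set {set E}}) (y : {set E} -> R) : Prop :=
  fractional_packing C y /\
  forall z : {set E} -> R, fractional_packing C z ->
    packing_value C z <= packing_value C y.

Definition packing_support (R : realType) (E : finType)
    (C : {set {set E}}) (y : {set E} -> R) : {set {set E}} :=
  [set H in C | 0 < y H]%SET.

(* A relation rather than a function: for C = [set set0] the packing values
   are unbounded and fpn does not exist. *)
Definition is_fpn (R : realType) (E : finType)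
    (C : {set {set E}}) (v : R) : Prop :=
  exists2 y : {set E} -> R, max_fractional_packing C y & v = packing_value C y.

Definition integral_blocking (R : realType) (E : finType)
    (C : {set {set E}}) : Prop :=
  is_fpn C ((bn C)%:R : R).

Definition tilde_invariant (R : realType) (E : finType)
    (C : {set {set E}}) : Prop :=
  C = tilde C /\ integral_blocking R C.

Definition tilde_full (R : realType) (E : finType)
    (C : {set {set E}}) : Prop :=
  [/\ min_transversal_covered C,
      integral_blocking R C
    & forall H : {set E}, H \in tilde C ->
        exists2 y : {set E} -> R,
          max_fractional_packing C y & H \in packing_support C y].

(* R^o makes {ffun E -> R^o} a finite-dimensional vector space over R. *)

Notation vec R E := {ffun E -> R^o}.

Definition indic (R : realType) (E : finType) (D : {set E}) : vec R E :=
  [ffun a => (a \in D)%:R].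

Definition dot (R : realType) (E : finType) (x z : vec R E) : R :=
  \sum_(a : E) (x a : R) * (z a : R).

(* The empty set has affine dimension -1. *)
Definition affdim (R : realType) (V : vectType R) (s : seq V) : int :=
  if s is [::] then -1 else (\dim <<[seq x - z | x <- s, z <- s]>>%VS)%:Z.

Definition dimension_condition (R : realType) (E : finType)
    (C : {set {set E}}) : Prop :=
  affdim [seq indic R H | H in tilde C]
    + affdim [seq indic R B | B in minb (tilde C)] = #|E|%:Z - 1.

(* Convex hulls of finite nonempty families.  Polytopes are thus nonempty; this
   matters only for the clutter without hyperedges, whose set I is empty. *)
Definition polytope (R : realType) (V : lmodType R) (P : set V) : Prop :=
  exists (n : nat) (v : 'I_n.+1 -> V),
    P = [set x : V | exists w : 'I_n.+1 -> R,
           [/\ forall i, 0 <= w i, \sum_i w i = 1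
             & x = \sum_i w i *: v i]]%classic.

Definition vertex (R : realType) (V : lmodType R) (P : set V) (x : V) : Prop :=
  P x /\
  forall (y z : V) (t : R), P y -> P z -> 0 < t < 1 ->
    x = t *: y + (1 - t) *: z -> y = x /\ z = x.

Definition integral_polytope (R : realType) (E : finType)
    (P : set (vec R E)) : Prop :=
  polytope P /\
  forall x : vec R E, vertex P x -> forall a : E, (x a : R) \is a Num.int.

Definition Iset (R : realType) (E : finType)
    (C : {set {set E}}) : set (vec R E) :=
  [set x : vec R E |
    [/\ forall D : {set E}, D \in minb C -> dot x (indic R D) = 1,
        forall D : {set E}, D \in transversals C -> 1 <= dot x (indic R D)
      & forall a : E, 0 <= (x a : R)]]%classic.

Arguments Iset R {E} C.

(* Main.v *)
(* Boundedness of I(C) forces minb(C) to cover E.  An integral vertex x of I(C)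
   is the indicator of some H in tilde C: the support of x meets every
   transversal, so it contains a hyperedge H, and x is the midpoint of 1_H and
   2x - 1_H, both in I(C).  Hence I(C) is the convex hull of the 1_H, H in tilde C.
   The constant vector 1/bn(C) lies in the relative interior of I(C), so it is a
   convex combination of the 1_H in which any prescribed H has positive weight;
   scaled by bn(C), this is a fractional packing of tilde C of value bn(C).
   Complementary slackness then makes every member of minb(tilde C) meet every
   member of tilde C exactly once.  Finally, the direction space of the affine hull
   of tilde C is the orthogonal complement of the span of minb(tilde C), and this
   span has dimension one more than the affine dimension of minb(tilde C). *)
From HB Require Import structures.
Require Import Defs.
From mathcomp Require Import all_boot all_order all_algebra.
From mathcomp Require Import boolp classical_sets reals.
From mathcomp Require Import ring lra.

Set Implicit Arguments.
Unset Strict Implicit.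
Unset Printing Implicit Defensive.

Import Order.TTheory GRing.Theory Num.Theory.
Local Open Scope ring_scope.

(** * Blockers and fractional packings *)

Lemma transversal_meets (E : finType) (C : {set {set E}}) (D : {set E}) :
  D \in transversals C -> meets_all C D.
Proof. by rewrite inE => /minsetP[]. Qed.

Lemma transversal_subset (E : finType) (C : {set {set E}}) (S : {set E}) :
  meets_all C S -> exists2 D, D \in transversals C & D \subset S.
Proof. by case/minset_exists=> D minD sDS; exists D; rewrite ?inE. Qed.

Lemma bn_le_card (E : finType) (C : {set {set E}}) (S : {set E}) :
  meets_all C S -> (bn C <= #|S|)%N.
Proof.
case/transversal_subset=> D DT /subset_leq_card; apply: leq_trans.
by rewrite /bn -minEnat -leEnat; apply: bigmin_le_cond.
Qed.

(** Without an empty hyperedge, [E] itself meets all hyperedges, so transversals exist and the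
    minimum in [bn] is attained despite its seed [#|E|]. *)
Lemma minb_exists (E : finType) (C : {set {set E}}) :
  finset.set0 \notin C -> exists B, B \in minb C.
Proof.
move=> C0.
have [|D0 D0T _] := @transversal_subset E C [set: E]%SET.
  by apply/forall_inP => H HC; rewrite finset.setTI; apply: contraNneq C0 => <-.
case: (arg_minnP (P := [in transversals C]) (fun D : {set E} => #|D|) D0T).
move=> B BT Bmin; exists B; rewrite inE BT eqn_leq /= bn_le_card ?andbT.
  by rewrite /bn -minEnat -leEnat; apply/bigmin_geP; split=> //; apply: max_card.
exact: transversal_meets.
Qed.

(** If no hyperedge lies in [S], the complement of [S] meets every hyperedge and so contains a
    transversal, which is disjoint from [S]. *)
Lemma blocker_blocker (E : finType) (C : {set {set E}}) (S : {set E}) :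
  (forall D, D \in transversals C -> S :&: D != finset.set0) ->
  exists2 H, H \in C & H \subset S.
Proof.
move=> meetS; have [/exists_inP//|noH] := boolP [exists H in C, H \subset S].
have [|D DT DS] := @transversal_subset E C (~: S)%SET.
  apply/forall_inP => H HC; move: noH; rewrite negb_exists_in => /forall_inP/(_ _ HC).
  by apply: contraNneq => /eqP; rewrite finset.setI_eq0 finset.disjoints_subset finset.setCS.
have := meetS _ DT.
by rewrite finset.setIC finset.setI_eq0 finset.disjoints_subset DS.
Qed.

(** Double counting of the pairs [(H, a)] with [a] in [H :&: B], each weighted by [y H]. *)
Lemma sum_packing_card (R : realType) (E : finType) (C : {set {set E}})
    (y : {set E} -> R) (B : {set E}) :
  \sum_(H in C) y H * #|H :&: B|%:R = \sum_(a in B) \sum_(H in C | a \in H) y H.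
Proof.
rewrite (exchange_big_dep [in C]) /=; last by move=> a H _ /andP[].
apply: eq_bigr => H HC; rewrite sumr_const -[RHS]mulr_natr; congr (_ * _%:R).
by apply: eq_card => a; rewrite !inE andbC HC.
Qed.

Lemma packing_sum_le (R : realType) (E : finType) (C : {set {set E}})
    (y : {set E} -> R) (B : {set E}) :
  fractional_packing C y -> \sum_(H in C) y H * #|H :&: B|%:R <= #|B|%:R.
Proof.
case=> _ y1; rewrite sum_packing_card -sum1_card natr_sum.
by apply: ler_sum => a _; apply: y1.
Qed.

Lemma meets_card_gt0 (E : finType) (C : {set {set E}}) (B H : {set E}) :
  meets_all C B -> H \in C -> (0 < #|H :&: B|)%N.
Proof. by move=> /forall_inP mB /mB; rewrite card_gt0 finset.setIC. Qed.

(** Weak linear programming duality: every hyperedge meets [B], so its weight is counted at least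
    once in [packing_sum_le]. *)
Lemma packing_value_le (R : realType) (E : finType) (C : {set {set E}})
    (y : {set E} -> R) (B : {set E}) :
  meets_all C B -> fractional_packing C y -> packing_value C y <= #|B|%:R.
Proof.
move=> mB py; apply: le_trans (packing_sum_le B py); apply: ler_sum => H HC.
by rewrite ler_peMr ?(proj1 py) // ler1n (meets_card_gt0 mB).
Qed.

(** Complementary slackness: the terms [y K * (#|K :&: B| - 1)] are nonnegative, and their sum is at
    most [#|B|] minus the packing value, which is zero. *)
Lemma packing_slackness (R : realType) (E : finType) (C : {set {set E}})
    (y : {set E} -> R) (B H : {set E}) :
  meets_all C B -> fractional_packing C y -> packing_value C y = #|B|%:R ->
  H \in C -> 0 < y H -> #|H :&: B| = 1%N.
Proof.
move=> mB py yB HC yH.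
have ge0 K : K \in C -> 0 <= y K * (#|K :&: B|%:R - 1).
  by move=> KC; rewrite mulr_ge0 ?(proj1 py) // subr_ge0 ler1n (meets_card_gt0 mB).
have : \sum_(K in C) y K * (#|K :&: B|%:R - 1) = 0.
  apply/eqP; rewrite eq_le sumr_ge0 // andbT.
  under eq_bigr do rewrite mulrBr mulr1.
  by rewrite sumrB subr_le0 -[leRHS]/(packing_value C y) yB packing_sum_le.
move/(psumr_eq0P ge0)/(_ _ HC)/eqP; rewrite mulf_eq0 gt_eqF //= subr_eq0.
by rewrite pnatr_eq1 => /eqP.
Qed.

(** By weak duality, equal values certify that both sides are optimal. [B] is inclusion-minimal
    because a transversal inside it has at least [#|B|] elements. *)
Lemma packing_certificate (R : realType) (E : finType) (C : {set {set E}})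
    (y : {set E} -> R) (B : {set E}) :
  meets_all C B -> fractional_packing C y -> packing_value C y = #|B|%:R ->
  [/\ max_fractional_packing C y, bn C = #|B| & B \in minb C].
Proof.
move=> mB py yB.
have [D DT sDB] := transversal_subset mB.
have card_ge S : meets_all C S -> (#|B| <= #|S|)%N.
  by move=> mS; rewrite -(ler_nat R) -yB packing_value_le.
have DB : D = B.
  by apply/eqP; rewrite eqEcard sDB card_ge // transversal_meets.
have BT : B \in transversals C by rewrite -DB.
have bnB : bn C = #|B|.
  apply/eqP; rewrite eqn_leq bn_le_card //= /bn -minEnat -leEnat.
  apply/bigmin_geP; split=> [|S ST]; first exact: max_card.
  by rewrite leEnat card_ge // transversal_meets.
split=> //; last by rewrite inE BT bnB eqxx.
by split=> // z pz; rewrite yB packing_value_le.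
Qed.

(** The empty hyperedge occurs in no packing constraint, so its weight could always be raised by one
    and no packing would be maximum. *)
Lemma fpn_set0_notin (R : realType) (E : finType) (C : {set {set E}}) (v : R) :
  clutter C -> is_fpn C v -> finset.set0 \notin C.
Proof.
move=> hC [y [[y0 y1] ymax] _]; apply/negP => C0.
pose z H := y H + (H == finset.set0)%:R.
have pz : fractional_packing C z.
  split=> [H HC|a]; first by rewrite addr_ge0 ?y0 ?ler0n.
  rewrite (eq_bigr y) ?y1 // => H /andP[_ aH].
  by rewrite /z; case: eqP aH => [->|_ _]; rewrite ?inE ?addr0.
have := ymax z pz; rewrite /packing_value big_split /=.
rewrite [X in _ + X](bigD1 finset.set0 C0) /= eqxx gerDl.
apply/negP; rewrite -ltNge; apply: ltr_pwDl => //.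
by apply: sumr_ge0 => H _; apply: ler0n.
Qed.

(** * Polytopes and their vertices *)

(** The weights range over all of [I] and vanish off [A], so that a generator is dropped by
    shrinking [A], without reindexing. *)
Definition hull (R : realType) (V : lmodType R) (I : finType) (A : {set I})
    (v : I -> V) (x : V) : Prop :=
  exists w : I -> R,
    [/\ forall i, 0 <= w i, forall i, i \notin A -> w i = 0, \sum_i w i = 1
      & x = \sum_i w i *: v i].

Lemma hull_point (R : realType) (V : lmodType R) (I : finType) (A : {set I})
    (v : I -> V) (i : I) :
  i \in A -> hull A v (v i).
Proof.
move=> iA; exists (fun j => (j == i)%:R); split=> [j|j jA||].
- exact: ler0n.
- by case: eqP jA => // ->; rewrite iA.
- by rewrite (bigD1 i) //= eqxx big1 ?addr0 // => j /negPf->.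
- rewrite (bigD1 i) //= eqxx scale1r big1 ?addr0 // => j /negPf->.
  by rewrite scale0r.
Qed.

Lemma hull_hull (R : realType) (V : lmodType R) (I J : finType) (A : {set I})
    (B : {set J}) (v : I -> V) (u : J -> V) (x : V) :
  (forall i, i \in A -> hull B u (v i)) -> hull A v x -> hull B u x.
Proof.
move=> vB [w [w0 wA w1 ->]].
have /choice[W HW] : forall i, exists Wi : J -> R, i \in A ->
    [/\ forall j, 0 <= Wi j, forall j, j \notin B -> Wi j = 0,
        \sum_j Wi j = 1 & v i = \sum_j Wi j *: u j].
  move=> i; have [iA|_] := boolP (i \in A); last by exists (fun=> 0).
  by have [Wi HWi] := vB i iA; exists Wi.
exists (fun j => \sum_i w i * W i j); split=> [j|j jB||].
- apply: sumr_ge0 => i _; have [iA|iA] := boolP (i \in A).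
    by rewrite mulr_ge0 ?w0 //; have [] := HW _ iA.
  by rewrite wA ?mul0r.
- apply: big1 => i _; have [iA|iA] := boolP (i \in A).
    by have [_ -> //] := HW _ iA; rewrite mulr0.
  by rewrite wA ?mul0r.
- rewrite exchange_big -w1 /=; apply: eq_bigr => i _; rewrite -mulr_sumr.
  have [iA|iA] := boolP (i \in A); last by rewrite wA ?mul0r.
  by have [_ _ -> _] := HW _ iA; rewrite mulr1.
- under [RHS]eq_bigr do rewrite scaler_suml.
  rewrite exchange_big /=; apply: eq_bigr => i _.
  under [RHS]eq_bigr do rewrite -scalerA.
  rewrite -scaler_sumr; have [iA|iA] := boolP (i \in A).
    by have [_ _ _ <-] := HW _ iA.
  by rewrite wA // !scale0r.
Qed.

Lemma sum_weight1 (R : realType) (V : lmodType R) (I : finType)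
    (w : I -> R) (v : I -> V) (i : I) :
  (forall j, 0 <= w j) -> \sum_j w j = 1 -> 1 <= w i ->
  \sum_j w j *: v j = v i.
Proof.
move=> w0 w1 wi.
have S0 : 0 <= \sum_(j | j != i) w j by apply: sumr_ge0.
move: w1; rewrite (bigD1 i) //= => w1.
have {}wi : w i = 1 by lra.
have {}S0 : \sum_(j | j != i) w j = 0 by lra.
rewrite (bigD1 i) //= wi scale1r big1 ?addr0 // => j ji.
by rewrite (psumr_eq0P _ S0) ?scale0r.
Qed.

(** Contrapositively, put [v i] strictly between two points [y] and [z] of [P] and expand both in
    the generators. This writes [v i] as a combination with weights [c], in which [v i] itself may
    occur. *)
Lemma hull_not_vertex (R : realType) (V : lmodType R) (I : finType)
    (A : {set I}) (v : I -> V) (P : V -> Prop) (i : I) :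
  (forall x, P x -> hull A v x) -> P (v i) -> ~ vertex P (v i) ->
  hull (A :\ i) v (v i).
Proof.
move=> PA Pvi nv; apply: contrapT => nh; apply: nv; split=> // y z t Py Pz t01 vi.
have [a [a0 aA a1 ya]] := PA _ Py; have [b [b0 bA b1 zb]] := PA _ Pz.
have [t0 t1] := andP t01.
pose c j := t * a j + (1 - t) * b j.
have c0 j : 0 <= c j.
  by rewrite addr_ge0 ?mulr_ge0 ?a0 ?b0 ?subr_ge0 //; apply: ltW.
have c1 : \sum_j c j = 1.
  by rewrite big_split -!mulr_sumr /= a1 b1 !mulr1; ring.
have vc : v i = \sum_j c j *: v j.
  rewrite {1}vi ya zb !scaler_sumr -big_split /=; apply: eq_bigr => j _.
  by rewrite /c [RHS]scalerDl !scalerA.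
have le1 (w : I -> R) : (forall j, 0 <= w j) -> \sum_j w j = 1 -> w i <= 1.
  by move=> w0 <-; rewrite (bigD1 i) //= lerDl sumr_ge0.
(* If [c i] reaches 1, so do [a i] and [b i], which are at most 1 and averaged with positive
   weights; then [y = z = v i]. *)
have [ci|ci] := ltP (c i) 1; last first.
  have ai := le1 _ a0 a1; have bi := le1 _ b0 b1.
  have ai1 : 1 <= a i by rewrite /c in ci; nra.
  have bi1 : 1 <= b i by rewrite /c in ci; nra.
  by rewrite ya zb !(@sum_weight1 _ _ _ _ _ i).
have d0 : 1 - c i != 0 by rewrite gt_eqF ?subr_gt0.
(* Otherwise the identity [vc] is solved for [v i], which leaves the other generators with weights
   divided by [1 - c i]. *)
case: nh; exists (fun j => if j == i then 0 else c j / (1 - c i)).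
split=> [j|j||].
- by case: ifP => // _; rewrite divr_ge0 ?c0 ?subr_ge0 ?ltW.
- rewrite !inE; case: eqP => //= _ jA.
  by rewrite /c aA // bA // !mulr0 addr0 mul0r.
- rewrite (bigD1 i) //= eqxx add0r; apply: (mulIf d0); rewrite mul1r mulr_suml.
  rewrite -[X in _ = X - _]c1 (bigD1 i erefl) /= [RHS]addrC addKr; apply: eq_bigr => j /negPf->.
  by rewrite divfK.
- rewrite (bigD1 i) //= eqxx scale0r add0r; apply: (scalerI d0).
  rewrite scalerBl scale1r {1}vc [in LHS](bigD1 i) //= [LHS]addrC addKr scaler_sumr.
  by apply: eq_bigr => j /negPf->; rewrite scalerA mulrC divfK.
Qed.

(* A generator that is not a vertex lies in the hull of the other generators
   and can be dropped. *)
Lemma hull_vertices (R : realType) (V : lmodType R) (I J : finType)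
    (A : {set I}) (B : {set J}) (v : I -> V) (u : J -> V) (P : V -> Prop) :
  (forall x, P x -> hull A v x) -> (forall i, i \in A -> P (v i)) ->
  (forall x, vertex P x -> hull B u x) -> forall x, P x -> hull B u x.
Proof.
move=> + + PB.
have [n] := ubnP #|A|; elim: n A => // n IHn A ltAn PA AP x Px.
have [allv|] := pselect (forall i, i \in A -> vertex P (v i)).
  by apply: hull_hull (PA _ Px) => i /allv; apply: PB.
move=> /existsNP[i /not_implyP[iA nvi]].
have hi := hull_not_vertex PA (AP _ iA) nvi.
apply: (IHn (A :\ i)%SET) Px => [|z Pz|j].
- by move: ltAn; rewrite (cardsD1 i) iA.
- apply: hull_hull (PA _ Pz) => j jA; have [->//|ji] := eqVneq j i.
  by apply: hull_point; rewrite !inE ji.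
- by rewrite !inE => /andP[_]; apply: AP.
Qed.

Lemma polytope_hull (R : realType) (V : lmodType R) (P : V -> Prop) :
  polytope P -> exists (n : nat) (v : 'I_n.+1 -> V),
    forall x, P x <-> hull [set: 'I_n.+1] v x.
Proof.
case=> n [v ->]; exists n, v => x; split=> [[w [w0 w1 ->]]|[w [w0 _ w1 ->]]].
  by exists w; split=> // i; rewrite inE.
by exists w.
Qed.

(** This form of the theorem that a polytope is the hull of its vertices avoids enumerating the
    vertices. *)
Lemma polytope_vertices (R : realType) (V : lmodType R) (J : finType)
    (B : {set J}) (u : J -> V) (P : V -> Prop) :
  polytope P -> (forall x, vertex P x -> hull B u x) ->
  forall x, P x -> hull B u x.
Proof.
case/polytope_hull=> n [v Pv]; apply: (@hull_vertices _ _ _ _ [set: _] _ v).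
- by move=> x /Pv.
- by move=> i iT; apply/Pv/hull_point.
Qed.

Lemma polytope_bounded (R : realType) (E : finType) (P : vec R E -> Prop) (a : E) :
  polytope P -> exists M : R, forall x, P x -> (x a : R) <= M.
Proof.
case/polytope_hull=> n [v Pv]; exists (\sum_i `|v i a : R|) => x /Pv[w [w0 _ w1 ->]].
rewrite sum_ffunE; apply: ler_sum => i _; rewrite ffunE.
have wi : w i <= 1 by rewrite -w1 (bigD1 i) //= lerDl sumr_ge0.
apply: le_trans (ler_norm _) _; rewrite -[w i *: _]/(w i * (v i a : R)) normrM (ger0_norm (w0 i)).
by rewrite ler_piMl.
Qed.

Lemma polytope_nonempty (R : realType) (V : lmodType R) (P : V -> Prop) :
  polytope P -> exists x, P x.
Proof.
by case/polytope_hull=> n [v Pv]; exists (v ord0); apply/Pv/hull_point; rewrite inE.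
Qed.

(** * Orthogonality and affine dimension *)

Lemma dotC (R : realType) (E : finType) (x z : vec R E) : dot x z = dot z x.
Proof. by apply: eq_bigr => a _; rewrite mulrC. Qed.

Lemma dotDl (R : realType) (E : finType) (x y z : vec R E) :
  dot (x + y) z = dot x z + dot y z.
Proof. by rewrite -big_split; apply: eq_bigr => a _; rewrite ffunE mulrDl. Qed.

Lemma dotZl (R : realType) (E : finType) (t : R) (x z : vec R E) :
  dot (t *: x) z = t * dot x z.
Proof. by rewrite mulr_sumr; apply: eq_bigr => a _; rewrite ffunE -mulrA. Qed.

Lemma dotBl (R : realType) (E : finType) (x y z : vec R E) :
  dot (x - y) z = dot x z - dot y z.
Proof. by rewrite -[- y]scaleN1r dotDl dotZl mulN1r. Qed.

Lemma dot_eq0 (R : realType) (E : finType) (x : vec R E) : dot x x = 0 -> x = 0.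
Proof.
move/(psumr_eq0P (fun a _ => sqr_ge0 (x a : R))) => x0.
by apply/ffunP => a; rewrite ffunE; apply/eqP; rewrite -sqrf_eq0 x0.
Qed.

Lemma dot_indic (R : realType) (E : finType) (x : vec R E) (D : {set E}) :
  dot x (indic R D) = \sum_(a in D) (x a : R).
Proof.
rewrite /dot [RHS]big_mkcond; apply: eq_bigr => a _.
by rewrite ffunE; case: (a \in D); rewrite ?mulr1 ?mulr0.
Qed.

Lemma dot_indic2 (R : realType) (E : finType) (H D : {set E}) :
  dot (indic R H) (indic R D) = #|H :&: D|%:R.
Proof.
rewrite dot_indic -sum1_card natr_sum finset.setIC.
rewrite [RHS](eq_bigl _ _ (fun a => finset.in_setI a D H)) big_mkcondr /=.
by apply: eq_bigr => a _; rewrite ffunE; case: (a \in H).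
Qed.

(** The kernel of this map is the orthogonal complement of the span of [b]. *)
Definition pairing (R : realType) (E : finType) (n : nat)
    (b : n.-tuple (vec R E)) (x : vec R E) : {ffun 'I_n -> R^o} :=
  [ffun i => dot x (tnth b i)].

Lemma pairing_is_linear (R : realType) (E : finType) (n : nat)
    (b : n.-tuple (vec R E)) : linear (pairing b).
Proof. by move=> t x y; apply/ffunP => i; rewrite !ffunE dotDl dotZl. Qed.

HB.instance Definition _ (R : realType) (E : finType) (n : nat)
    (b : n.-tuple (vec R E)) :=
  GRing.isLinear.Build R (vec R E) {ffun 'I_n -> R^o} *:%R (pairing b)
    (pairing_is_linear b).

Lemma dot_span_eq0 (R : realType) (E : finType) (s : seq (vec R E))
    (w x : vec R E) :
  (forall b, b \in s -> dot w b = 0) -> x \in <<s>>%VS -> dot w x = 0.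
Proof.
move=> ws xs; suff /subvP/(_ x xs) : (<<s>> <= lker (linfun (pairing [tuple w])))%VS.
  rewrite memv_ker lfunE /= => /eqP/ffunP/(_ ord0).
  by rewrite !ffunE (tnth_nth 0) dotC.
apply/span_subvP => b /ws wb; rewrite memv_ker lfunE /=; apply/eqP/ffunP => i.
by rewrite !ffunE ord1 (tnth_nth 0) dotC.
Qed.

Lemma dim_ffun_regular (R : realType) (I : finType) : \dim {: vec R I} = #|I|.
Proof. by rewrite dimvf /dim /= muln1. Qed.

(** Rank-nullity for the pairing with a basis of [<<s>>], whose kernel is [W]. Its rank is
    [\dim <<s>>]: the codomain bounds it above, and below it is bounded by injectivity on [<<s>>],
    since a vector orthogonal to itself is zero. *)
Lemma dim_orthogonal (R : realType) (E : finType) (s : seq (vec R E))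
    (W : {vspace vec R E}) :
  (forall w, reflect (forall b, b \in s -> dot w b = 0) (w \in W)) ->
  (\dim W + \dim <<s>> = #|E|)%N.
Proof.
move=> WP; pose b := vbasis <<s>>%VS; pose f := linfun (pairing b).
have span_b : <<b>>%VS = <<s>>%VS by apply/eqP; case/andP: (vbasisP <<s>>%VS).
have kerP w : (w \in lker f) = (w \in W).
  rewrite memv_ker lfunE; apply/eqP/WP => [wb x xs|ws].
    apply: (@dot_span_eq0 _ _ b) => [y|]; last by rewrite span_b memv_span.
    by case/tnthP=> i ->; move/ffunP/(_ i): wb; rewrite !ffunE.
  apply/ffunP => i; rewrite !ffunE; apply: dot_span_eq0 ws _.
  by rewrite vbasis_mem ?mem_tnth.
have -> : W = lker f by apply/vspaceP => w; rewrite kerP.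
rewrite -(dim_ffun_regular R) -(limg_ker_dim f fullv) capfv; congr addn.
apply/eqP; rewrite eqn_leq; apply/andP; split.
  have dim_img : \dim (f @: <<s>>) = \dim <<s>>.
    apply: limg_dim_eq; apply/eqP; rewrite -subv0; apply/subvP => w.
    rewrite memv_cap memv0 => /andP[ws].
    by rewrite kerP => /WP/dot_span_eq0/(_ ws)/dot_eq0->.
  by apply: leq_trans (eq_leq (esym dim_img)) _; rewrite dimvS ?limgS ?subvf.
by apply: leq_trans (dimvS (subvf _)) _; rewrite dim_ffun_regular card_ord.
Qed.

(** Pairing with [h] gives 1 on [s] and hence 0 on differences, so the span is the direct sum of the
    difference space and the line through any one [b] in [s]. *)
Lemma dim_affine_span (R : realType) (E : finType) (h : vec R E)
    (s : seq (vec R E)) :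
  s != [::] -> (forall b, b \in s -> dot h b = 1) ->
  \dim <<s>> = (\dim <<[seq x - z | x <- s, z <- s]>>).+1.
Proof.
move=> s0 hs; set U := (<<[seq x - z | x <- s, z <- s]>>)%VS.
have [b bs] : exists b, b \in s by case: s s0 {hs U} => // b s; exists b; rewrite mem_head.
have hU x : x \in U -> dot h x = 0.
  apply: dot_span_eq0 => _ /allpairsP[[y z] /= [ys zs ->]].
  by rewrite dotC dotBl ![dot _ h]dotC !hs ?subrr.
have -> : (<<s>> = <[b]> + U)%VS.
  apply/eqP; rewrite eqEsubv; apply/andP; split.
    apply/span_subvP => x xs; rewrite -(subrKC b x) memv_add ?memv_line //.
    by apply/memv_span/allpairs_f.
  rewrite subv_add -memvE memv_span //=; apply/span_subvP => _ /allpairsP[[y z] /= [ys zs ->]].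
  by rewrite memvB ?memv_span.
rewrite dimv_disjoint_sum ?dim_vline.
  suff -> : b != 0 by [].
  apply: contraTneq (oner_neq0 R) => b0; rewrite -(hs b bs) b0 dotC.
  by rewrite -(scale0r h) dotZl mul0r eqxx.
apply/eqP; rewrite -subv0; apply/subvP => x; rewrite memv_cap => /andP[/vlineP[t {x}->]].
move/hU; rewrite dotC dotZl dotC hs // mulr1 => ->.
by rewrite scale0r mem0v.
Qed.

Lemma affdimE (R : realType) (V : vectType R) (s : seq V) :
  s != [::] -> affdim s = (\dim <<[seq x - z | x <- s, z <- s]>>%VS)%:Z.
Proof. by case: s. Qed.

(** * The polyhedron I(C) *)

Lemma minb_transversal (E : finType) (C : {set {set E}}) (B : {set E}) :
  B \in minb C -> B \in transversals C.
Proof. by rewrite inE => /andP[]. Qed.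

Lemma minb_card (E : finType) (C : {set {set E}}) (B : {set E}) :
  B \in minb C -> #|B| = bn C.
Proof. by rewrite inE => /andP[_ /eqP]. Qed.

Lemma tilde_card (E : finType) (C : {set {set E}}) (H B : {set E}) :
  H \in tilde C -> B \in minb C -> #|H :&: B| = 1%N.
Proof. by rewrite inE => /andP[_ /forall_inP h] /h/eqP. Qed.

Lemma tilde_sub (E : finType) (C : {set {set E}}) (H : {set E}) :
  H \in tilde C -> H \in C.
Proof. by rewrite inE => /andP[]. Qed.

(** Serves both for the unbounded ray through an uncovered point and for the reflected point
    [x + (x - indic R H)] at a vertex. *)
Lemma Iset_up (R : realType) (E : finType) (C : {set {set E}}) (x u : vec R E) :
  Iset R C x -> (forall a, 0 <= (u a : R)) ->
  (forall B, B \in minb C -> dot u (indic R B) = 0) -> Iset R C (x + u).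
Proof.
move=> [x1 xge x0] u0 uB; split=> [D DB|D DT|a].
- by rewrite dotDl x1 // uB // addr0.
- rewrite dotDl -[1]addr0 lerD ?xge // dot_indic.
  by apply: sumr_ge0 => a _.
- by rewrite ffunE addr_ge0.
Qed.

(* Otherwise the ray in the direction of an uncovered point stays in I(C). *)
Lemma Iset_covered (R : realType) (E : finType) (C : {set {set E}}) :
  polytope (Iset R C) -> min_transversal_covered C.
Proof.
move=> polyI; apply/eqP; rewrite finset.eqEsubset finset.subsetT /=; apply/fintype.subsetP => a _.
apply: contraT => aC.
have [x Ix] := polytope_nonempty polyI.
have [M Mge] := polytope_bounded a polyI.
pose t := `|M| + 1.
have : Iset R C (x + t *: indic R [set a]%SET).
  apply: Iset_up => // [b|B BC].
    by rewrite !ffunE mulr_ge0 ?ler0n // addr_ge0.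
  rewrite dotZl dot_indic2; have [aB|aB] := boolP (a \in B).
    by case/negP: aC; apply/finset.bigcupP; exists B.
  suff -> : ([set a] :&: B)%SET = finset.set0 by rewrite cards0 mulr0.
  by apply/eqP; rewrite finset.setI_eq0 disjoints1.
move/Mge; rewrite !ffunE inE eqxx; have [_ _ /(_ a) xa] := Ix.
rewrite -[_ *: _]/(t * 1) mulr1; have := ler_norm M; rewrite /t; lra.
Qed.

Lemma Iset_vertex (R : realType) (E : finType) (C : {set {set E}}) (x : vec R E) :
  vertex (Iset R C) x -> (forall a, (x a : R) \is a Num.int) ->
  exists2 H, H \in tilde C & x = indic R H.
Proof.
move=> [Ix vx] intx; have [x1 xge x0] := Ix.
pose S := [set a | 0 < (x a : R)]%SET.
have [|H HC HS] := @blocker_blocker E C S.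
  move=> D /xge; apply: contraTneq => SD0; rewrite -ltNge dot_indic big1 ?ltr01 // => a aD.
  apply/eqP; rewrite eq_le x0 andbT leNgt; apply/negP => xa.
  by have := finset.in_set0 a; rewrite -SD0 !inE xa aD.
(* Integrality enters here: a positive coordinate of [x] is at least 1. *)
have Hx a : (indic R H a : R) <= x a.
  rewrite ffunE; case: (boolP (a \in H)) => [/(fintype.subsetP HS)|_ //].
  rewrite inE => xa; have /natrP[n xn] : (x a : R) \is a Num.nat.
    by rewrite Num.Theory.natrEint intx x0.
  by move: xa; rewrite xn ltr0n ler1n.
have dotH D : dot (indic R H) (indic R D) <= dot x (indic R D).
  by rewrite !dot_indic ler_sum.
have cardH D : D \in transversals C -> (0 < #|H :&: D|)%N.
  by move/transversal_meets/meets_card_gt0; apply.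
have HT : H \in tilde C.
  rewrite inE HC; apply/forall_inP => D DB.
  rewrite eqn_leq cardH ?minb_transversal // andbT.
  by rewrite -(ler_nat R) -dot_indic2 (le_trans (dotH D)) // x1.
have IH : Iset R C (indic R H).
  split=> [D DB|D DT|a]; last by rewrite ffunE ler0n.
  - by rewrite dot_indic2 (tilde_card HT).
  - by rewrite dot_indic2 ler1n cardH.
exists H => //.
(* The vertex [x] is the midpoint of [indic R H] and this point, so both coincide with [x]. *)
have Ix' : Iset R C (x + (x - indic R H)).
  apply: Iset_up => // [a|D DB]; first by have := Hx a; rewrite !ffunE -subr_ge0.
  by rewrite dotBl x1 // dot_indic2 (tilde_card HT) // subrr.
have [||-> //] := vx _ _ (2^-1) IH Ix'; first by lra.
have half (p q : R) : q = 2^-1 * p + (1 - 2^-1) * (q + (q - p)) by field.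
by apply/ffunP => a; rewrite !ffunE; apply: half.
Qed.

Lemma Iset_hull (R : realType) (E : finType) (C : {set {set E}}) (x : vec R E) :
  integral_polytope (Iset R C) -> Iset R C x -> hull (tilde C) (@indic R E) x.
Proof.
case=> polyI intI; apply: polytope_vertices polyI _ _ => z vz.
by have [H HT ->] := Iset_vertex vz (intI z vz); apply: hull_point.
Qed.

Definition center (R : realType) (E : finType) (k : nat) : vec R E :=
  k%:R^-1 *: indic R [set: E].

Lemma dot_center (R : realType) (E : finType) (k : nat) (D : {set E}) :
  dot (center R E k) (indic R D) = #|D|%:R / k%:R.
Proof. by rewrite dotZl dot_indic2 finset.setTI mulrC. Qed.

(* The constant vector 1 / bn satisfies every inequality of I(C) strictly, except
   those that are turned into equations. *)
Lemma Iset_interior (R : realType) (E : finType) (C : {set {set E}}) (w : vec R E) :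
  (0 < bn C)%N -> (forall B, B \in minb C -> dot w (indic R B) = 0) ->
  exists2 e : R, 0 < e & Iset R C (center R E (bn C) + e *: w).
Proof.
move=> k0 wB; set k := bn C in k0 *; pose r : R := k%:R.
have r0 : 0 < r by rewrite ltr0n.
(* [N] exceeds the absolute value of every coordinate of [w] and of every [dot w (indic R D)], so a
   step of length [e] changes each of these quantities by less than [r^-1]. *)
pose N := 1 + \sum_a `|w a : R|.
have S0 : 0 <= \sum_a `|w a : R| by apply: sumr_ge0.
have N0 : 0 < N by rewrite /N; lra.
pose e := (r * N)^-1.
have e0 : 0 < e by rewrite invr_gt0 mulr_gt0.
have eN z : - (N : R) <= z -> 0 <= r^-1 + e * z.
  move=> zN; have -> : r^-1 = e * N by rewrite /e invfM divfK // gt_eqF.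
  by rewrite -mulrDr mulr_ge0 ?(ltW e0) //; lra.
exists e => //; split=> [D DB|D DT|a].
- by rewrite dotDl dotZl wB // mulr0 addr0 dot_center (minb_card DB) divff ?gt_eqF.
- have [Dk|Dk] := eqVneq #|D| k.
    have DB : D \in minb C by rewrite inE DT Dk eqxx.
    by rewrite dotDl dotZl wB // mulr0 addr0 dot_center Dk divff ?gt_eqF.
  have ltkD : (k < #|D|)%N.
    by rewrite ltn_neqAle eq_sym Dk bn_le_card // transversal_meets.
  rewrite dotDl dotZl dot_center.
  (* A transversal that is not of minimum size has at least one more element, hence slack at least
     [r^-1]. *)
  have : 1 + r^-1 <= #|D|%:R / r.
    by rewrite -{1}(@divff _ r) ?gt_eqF // -[X in _ + X]mul1r -mulrDl ler_pM2r ?invr_gt0 // natr1 ler_nat.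
  suff : 0 <= r^-1 + e * dot w (indic R D) by rewrite /r; lra.
  apply: eN; rewrite dot_indic.
  have : `|\sum_(a in D) (w a : R)| <= \sum_a `|w a : R|.
    apply: le_trans (ler_norm_sum _ _ _) _.
    by rewrite [leRHS](bigID [in D]) /= lerDl sumr_ge0.
  by rewrite ler_norml /N => /andP[]; lra.
- rewrite !ffunE inE.
  suff : 0 <= r^-1 + e * (w a : R) by rewrite -![_ *: _]/(_ * _) mulr1.
  apply: eN; have : `|w a : R| <= \sum_b `|w b : R|.
    by rewrite [leRHS](bigD1 a) //= lerDl sumr_ge0.
  by rewrite ler_norml /N => /andP[]; lra.
Qed.

(** Since the weights sum to 1, each point of the hull differs from a fixed generator [v j] by a
    combination of the [v i - v j]. *)
Lemma hull_sub_span (R : realType) (V : vectType R) (I : finType) (A : {set I})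
    (v : I -> V) (x z : V) :
  hull A v x -> hull A v z ->
  x - z \in <<[seq p - q | p <- [seq v i | i in A], q <- [seq v i | i in A]]>>%VS.
Proof.
set U := (<<_>>)%VS.
have vU i j : i \in A -> j \in A -> v i - v j \in U.
  by move=> iA jA; apply/memv_span/allpairs_f; apply: fintype.image_f.
have xU y j : j \in A -> hull A v y -> y - v j \in U.
  move=> jA [w [_ wA w1 ->]]; rewrite -[v j]scale1r -w1 scaler_suml -sumrB.
  apply: memv_suml => i _; rewrite -scalerBr.
  have [iA|iA] := boolP (i \in A); first by rewrite memvZ ?vU.
  by rewrite wA // scale0r mem0v.
move=> hx hz; have [A0|[j jA]] := finset.set_0Vmem A.
  have [w [_ wA w1 _]] := hx; move/eqP: w1.
  by rewrite big1 1?eq_sym ?oner_eq0 // => i _; rewrite wA // A0 inE.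
have -> : x - z = (x - v j) - (z - v j) by rewrite opprB addrA subrK.
by rewrite memvB ?xU.
Qed.

(* Push the point 1 / bn slightly away from the indicator of H, inside I(C). *)
Lemma tilde_packing (R : realType) (E : finType) (C : {set {set E}}) (H : {set E}) :
  (0 < bn C)%N -> (forall x, Iset R C x -> hull (tilde C) (@indic R E) x) ->
  H \in tilde C ->
  exists y : {set E} -> R, [/\ fractional_packing (tilde C) y,
    packing_value (tilde C) y = (bn C)%:R & 0 < y H].
Proof.
move=> k0 IT HT; set k := bn C in k0 *.
have r0 : 0 < k%:R :> R by rewrite ltr0n.
have [B BC|e e0 /IT[w [w0 wT w1 wE]]] :=
    @Iset_interior R E C (center R E k - indic R H) k0.
  by rewrite dotBl dot_center dot_indic2 (tilde_card HT) // (minb_card BC) divff ?subrr ?gt_eqF.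
have d0 : 0 < 1 + e by lra.
(* Solving [center + e *: (center - indic R H) = \sum_K w K *: indic R K] for the center gives these
   weights; that of [H] is at least [e / (1 + e)]. *)
pose c K := (w K + e * (K == H)%:R) / (1 + e).
have c0 K : 0 <= c K.
  by rewrite divr_ge0 ?(ltW d0) // addr_ge0 // mulr_ge0 ?ler0n // ltW.
have cT K : K \notin tilde C -> c K = 0.
  move=> KT; rewrite /c wT //; case: eqP KT => [->|_ _]; first by rewrite HT.
  by rewrite mulr0 addr0 mul0r.
have sumT (F : {set E} -> R) : \sum_(K in tilde C) c K * F K = \sum_K c K * F K.
  rewrite [RHS](bigID [in tilde C]) /= [X in _ + X]big1 ?addr0 // => K KT.
  by rewrite cT // mul0r.
have sumH (F : {set E} -> R) : \sum_K (K == H)%:R * F K = F H.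
  by rewrite (bigD1 H) //= eqxx mul1r big1 ?addr0 // => K /negPf->; rewrite mul0r.
have sumc (F : {set E} -> R) :
    \sum_K c K * F K = (\sum_K w K * F K + e * F H) / (1 + e).
  rewrite -(sumH F) mulr_sumr -big_split mulr_suml; apply: eq_bigr => K _ /=.
  by rewrite /c; ring.
have c1 : \sum_(K in tilde C) c K = 1.
  transitivity (\sum_(K in tilde C) c K * 1); first by apply: eq_bigr => K _; rewrite mulr1.
  rewrite sumT sumc; under eq_bigr do rewrite mulr1.
  by rewrite w1 mulr1 divff ?gt_eqF.
have ca a : \sum_(K in tilde C) c K * (a \in K)%:R = k%:R^-1.
  rewrite sumT sumc.
  have := congr1 (fun f : vec R E => f a : R) wE.
  rewrite sum_ffunE !ffunE inE.
  under eq_bigr do rewrite !ffunE.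
  rewrite -/k => <-; rewrite -![_ *: _]/(_ * _) mulr1.
  by field; rewrite !gt_eqF.
exists (fun K => k%:R * c K); split=> [|| ].
- split=> [K KT|a]; first by rewrite mulr_ge0 // ltW.
  rewrite -mulr_sumr big_mkcondr /=.
  have -> : \sum_(K in tilde C) (if a \in K then c K else 0) = k%:R^-1.
    by rewrite -(ca a); apply: eq_bigr => K _; case: (a \in K); rewrite ?mulr1 ?mulr0.
  by rewrite divff ?gt_eqF.
- by rewrite /packing_value -mulr_sumr c1 mulr1.
- rewrite mulr_gt0 // divr_gt0 // eqxx mulr1.
  by apply: ltr_wpDl.
Qed.

Theorem theorem3p31 (R : realType) (E : finType) (C : {set {set E}})
    (hC : clutter C)
    (hblock : integral_blocking R C)
    (hI : integral_polytope (Iset R C)) :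
  [/\ min_transversal_covered (tilde C),
      tilde_invariant R (tilde C),
      tilde_full R (tilde C)
    & dimension_condition R (tilde C)].
Proof.
have covC := Iset_covered (proj1 hI).
have IT := fun x => @Iset_hull R E C x hI.
have [x Ix] := polytope_nonempty (proj1 hI).
have [B0 B0C] := minb_exists (fpn_set0_notin hC hblock).
(* Otherwise the empty set would be a minimum transversal, and its equation at [x] would read 0 =
   1. *)
have k0 : (0 < bn C)%N.
  rewrite -(minb_card B0C) lt0n cards_eq0; apply/eqP => B00.
  have [/(_ _ B0C)/eqP + _ _] := Ix.
  by rewrite B00 dot_indic big1 ?(eq_sym 0) ?oner_eq0 // => a; rewrite inE.
have [H0 H0T] : exists H, H \in tilde C.
  have [w [_ wT w1 _]] := IT _ Ix; apply: contrapT => noH; move/eqP: w1.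
  rewrite big1 1?eq_sym ?oner_eq0 // => K _; apply: wT; apply/negP => KT.
  by apply: noH; exists K.
have meets B : B \in minb C -> meets_all (tilde C) B.
  move=> BC; apply/forall_inP => H HT; rewrite -card_gt0 finset.setIC.
  by rewrite (tilde_card HT).
have [y0 [py0 vy0 _]] := tilde_packing k0 IT H0T.
(* The packing [y0] of value [bn C] certifies that [B] is still of minimum size for [tilde C]. *)
have minbCT B : B \in minb C -> B \in minb (tilde C).
  move=> BC; have [] // := packing_certificate (meets B BC) py0.
  by rewrite vy0 (minb_card BC).
have [maxy0 bnT _] : [/\ max_fractional_packing (tilde C) y0,
    bn (tilde C) = #|B0| & B0 \in minb (tilde C)].
  by apply: packing_certificate => //; [apply: meets | rewrite vy0 (minb_card B0C)].
have {}bnT : bn (tilde C) = bn C by rewrite bnT (minb_card B0C).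
(* Slackness is applied to a packing chosen to have [H] in its support; a new member of
   [minb (tilde C)] is thus covered as well. *)
have one H B : H \in tilde C -> B \in minb (tilde C) -> #|H :&: B| = 1%N.
  move=> HT BT; have [y [py vy yH]] := tilde_packing k0 IT HT.
  apply: packing_slackness py _ HT yH; first exact/transversal_meets/minb_transversal.
  by rewrite vy (minb_card BT) bnT.
have covT : min_transversal_covered (tilde C).
  apply/eqP; rewrite finset.eqEsubset finset.subsetT -covC; apply/finset.bigcupsP => B /minbCT.
  exact: finset.bigcup_sup.
have blockT : integral_blocking R (tilde C) by exists y0; rewrite // vy0 bnT.
have invT : tilde C = tilde (tilde C).
  apply/eqP; rewrite finset.eqEsubset; apply/andP; split; apply/fintype.subsetP => H HT.
    by rewrite inE HT; apply/forall_inP => B BT; rewrite one.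
  exact: tilde_sub HT.
split=> //; first split=> //.
  move=> H; rewrite -invT => HT; have [y [py vy yH]] := tilde_packing k0 IT HT.
  exists y; last by rewrite inE HT.
  have [] // := packing_certificate (meets B0 B0C) py.
  by rewrite vy (minb_card B0C).
rewrite /dimension_condition -invT !affdimE; last first.
- by rewrite -size_eq0 size_map -cardE -lt0n; apply/card_gt0P; exists H0.
- by rewrite -size_eq0 size_map -cardE -lt0n; apply/card_gt0P; exists B0; apply: minbCT.
set s := [seq indic R B | B in minb (tilde C)].
set W := (<<[seq x - z | x <- [seq indic R H | H in tilde C], z <- _]>>)%VS.
have s0 : s != [::].
  by rewrite -size_eq0 size_map -cardE -lt0n; apply/card_gt0P; exists B0; apply: minbCT.
have WP w : reflect (forall b, b \in s -> dot w b = 0) (w \in W).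
  apply: (iffP idP) => [wW b /fintype.imageP[B BT ->]|ws].
    rewrite dotC; apply: dot_span_eq0 wW => _ /allpairsP[[p q] /= [/fintype.imageP[H HT ->] /fintype.imageP[K KT ->] ->]].
    by rewrite dotC dotBl !dot_indic2 !one // subrr.
  have wB B : B \in minb C -> dot w (indic R B) = 0.
    by move=> BC; apply: ws; apply: fintype.image_f; apply: minbCT.
  (* The center, obtained with direction 0, and its shift by [e *: w] are both in the hull of the
     indicators, so their difference [e *: w] is in [W]. *)
  have [e e0 /IT he] := Iset_interior k0 wB.
  have [|d d0 /IT h0] := @Iset_interior R E C 0 k0.
    by move=> B _; rewrite -(scale0r w) dotZl mul0r.
  have := hull_sub_span he h0; rewrite scaler0 addr0 addrC addKr => /(memvZ e^-1).
  by rewrite scalerA mulVf ?scale1r // gt_eqF.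
(* [indic R H0] pairs to 1 with all of [s], so [\dim <<s>>] exceeds the affine dimension of [s] by
   one; this is the -1 in the dimension condition. *)
have := dim_orthogonal WP; rewrite (@dim_affine_span _ _ (indic R H0) s s0).
  by move=> <-; rewrite addnS -addn1 !PoszD addrK.
by move=> b /fintype.imageP[B BT ->]; rewrite dot_indic2 one.
Qed.
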